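(* Let $D=(V,A)$ be a digraph, $s\in V$, $k$ a positive integer, and for every $v\in V-s$ let $M_v=(\delta^{in}_D(v),r_v)$ be a matroid with $r_v(\delta^{in}_D(v))=k$. Assume that $r^\oplus(\delta^{in}_D(X))\ge k$ for every nonempty $X\subseteq V-s$. Then the set function $p:2^{\delta^{out}_D(s)}\to\mathbb{R}$, \[p(E)=\max\{k-r^\oplus(\delta^{in}_{D-E}(X)):\ \emptyset\ne X\subseteq V-s\},\] is near supermodular.
   Context: $\delta^{in}_H(X)$ is the set of arcs of digraph $H$ with head in $X$ and tail outside $X$; $\delta^{out}_D(s)$ is the set of arcs leaving $s$; $D-E$ is $D$ with the arcs of $E$ deleted. $r^\oplus(F)=\sum_{v\in V-s}r_v(F\cap\delta^{in}_D(v))$. For a set function $p$ on $2^S$, a set $X\subseteq S$ is separable if there is a partition $X_1,\dots,X_t$ of $X$ with $p(X)\le\sum_i p(X_i)$; $p$ is near supermodular if $p(X)+p(Y)\le p(X\cap Y)+p(X\cup Y)$ for every pair of non-separable sets $X,Y$ with $X\cap Y\ne\emptyset$. *)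

(* Defs.v *)
From HB Require Import structures.
From mathcomp Require Import all_boot all_order all_algebra.
Set Implicit Arguments.
Unset Strict Implicit.
Unset Printing Implicit Defensive.
Import Order.TTheory GRing.Theory Num.Theory.
Local Open Scope ring_scope.

(* Finite digraphs with named arcs, so parallel arcs and loops are allowed;
   the arcs are the elements of [arcs], a subset of the type [A]. *)
Record digraph (V A : finType) := Digraph {
  arcs : {set A};
  tail : A -> V;
  head : A -> V
}.

Definition del_arcs (V A : finType) (D : digraph V A) (E : {set A}) :
  digraph V A := Digraph (arcs D :\: E) (tail D) (head D).

Definition delta_in (V A : finType) (D : digraph V A) (X : {set V}) : {set A} :=
  [set a in arcs D | (head D a \in X) && (tail D a \notin X)].

Definition delta_out (V A : finType) (D : digraph V A) (X : {set V}) : {set A} :=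
  [set a in arcs D | (tail D a \in X) && (head D a \notin X)].

(* (S, r) is a matroid given by its rank function; the values of r on sets
   that are not contained in S are irrelevant. *)
Record is_matroid (A : finType) (S : {set A}) (r : {set A} -> nat) : Prop := {
  rank_le_card : forall F : {set A}, F \subset S -> (r F <= #|F|)%N;
  rank_mono : forall F G : {set A}, F \subset G -> G \subset S -> (r F <= r G)%N;
  rank_submod : forall F G : {set A}, F \subset S -> G \subset S ->
    (r (F :&: G) + r (F :|: G) <= r F + r G)%N
}.

Definition rank_sum (V A : finType) (D : digraph V A) (s : V)
    (r : V -> {set A} -> nat) (F : {set A}) : nat :=
  \sum_(v : V | v != s) r v (F :&: delta_in D [set v]).

(* A partition has nonempty parts, and at least two of them: with the
   one-part partition allowed, every nonempty set would be separable. *)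
Definition separable_set (A : finType) (R : realFieldType)
    (p : {set A} -> R) (X : {set A}) : Prop :=
  exists P : {set {set A}},
    [/\ partition P X, (1 < #|P|)%N & p X <= \sum_(Y in P) p Y].

(* Near supermodularity of p as a set function on 2^S. *)
Definition near_supermodular (A : finType) (R : realFieldType) (S : {set A})
    (p : {set A} -> R) : Prop :=
  forall X Y : {set A}, X \subset S -> Y \subset S ->
    ~ separable_set p X -> ~ separable_set p Y -> X :&: Y != set0 ->
    p X + p Y <= p (X :&: Y) + p (X :|: Y).

Definition deficiency (V A : finType) (R : realFieldType) (D : digraph V A)
    (s : V) (k : nat) (r : V -> {set A} -> nat) (E : {set A}) (X : {set V}) : R :=
  k%:R - (rank_sum D s r (delta_in (del_arcs D E) X))%:R.

(* The default value of the iterated maximum is the term for X = V - s, which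
   is in the range of the maximum unless V = {s}; see [max_deficiency_spec].
   If V = {s}, no arc leaves s and the value is immaterial. *)
Definition max_deficiency (V A : finType) (R : realFieldType) (D : digraph V A)
    (s : V) (k : nat) (r : V -> {set A} -> nat) (E : {set A}) : R :=
  \big[Num.max/deficiency R D s k r E (~: [set s])]_(X : {set V} |
      (X != set0) && (X \subset ~: [set s])) deficiency R D s k r E X.

Lemma max_deficiency_spec (V A : finType) (R : realFieldType) (D : digraph V A)
    (s : V) (k : nat) (r : V -> {set A} -> nat) (E : {set A}) :
  ~: [set s] != set0 ->
  (exists X : {set V}, [/\ X != set0, X \subset ~: [set s]
     & max_deficiency R D s k r E = deficiency R D s k r E X]) /\
  (forall X : {set V}, X != set0 -> X \subset ~: [set s] ->
     deficiency R D s k r E X <= max_deficiency R D s k r E).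
Proof.
move=> Vs; split; last first.
  by move=> X X0 Xs; rewrite /max_deficiency; apply: le_bigmax_cond; rewrite X0.
rewrite /max_deficiency; elim/big_ind: _ => [|x y [X [? ? ->]] [Y [? ? ->]]|X].
- by exists (~: [set s]).
- by rewrite maxEle; case: ifP => _; [exists Y | exists X].
- by case/andP=> X0 Xs; exists X.
Qed.

(* Main.v *)
(* For arc sets E, F leaving s and X, Y avoiding s, submodularity of the
   matroid ranks "uncrosses" the pairs (E, X), (F, Y) into (E :&: F, X :&: Y),
   (E :|: F, X :|: Y): an arc leaving s that is not in both E and F survives one
   of the two deletions, and its tail s lies in neither X nor Y.  If X and Y
   attain p E and p F, this is the required inequality as soon as X and Y meet.
   They do when E and F are non-separable with at least two elements: an arc a
   of E with head outside X would give p E <= p (E :\ a) <= p (E :\ a) + p [set a],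
   so X contains all heads of E, Y those of F, and E meets F.  If E or F is a
   singleton, E and F are nested and the inequality is trivial. *)
Require Import Defs.
From HB Require Import structures.
From mathcomp Require Import all_boot all_order all_algebra.
Set Implicit Arguments.
Unset Strict Implicit.
Unset Printing Implicit Defensive.
Import Order.TTheory GRing.Theory Num.Theory.
Local Open Scope ring_scope.

Lemma matroid_rank0 (A : finType) (S : {set A}) (r : {set A} -> nat) :
  is_matroid S r -> r set0 = 0%N.
Proof.
by move=> m; apply/eqP; rewrite -leqn0 -(@cards0 A) (rank_le_card m) ?sub0set.
Qed.

(** Monotonicity relaxes submodularity, so that uncrossing cuts only requires checking two
    inclusions. *)
Lemma rank_submod_sub (A : finType) (S : {set A}) (r : {set A} -> nat)
    (B1 B2 C1 C2 : {set A}) :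
  is_matroid S r -> B1 \subset S -> B2 \subset S ->
  C1 \subset B1 :&: B2 -> C2 \subset B1 :|: B2 ->
  (r C1 + r C2 <= r B1 + r B2)%N.
Proof.
move=> m sB1 sB2 sC1 sC2; apply: leq_trans (rank_submod m sB1 sB2).
by rewrite leq_add // (rank_mono m) // ?subUset ?sB1 // subIset ?sB1.
Qed.

Section Deficiency.

Variables (R : realFieldType) (V A : finType) (D : digraph V A) (s : V).
Variables (k : nat) (r : V -> {set A} -> nat).
Hypothesis r_matroid :
  forall v : V, v != s -> is_matroid (delta_in D [set v]) (r v).
Hypothesis r_rank : forall v : V, v != s -> r v (delta_in D [set v]) = k.

Local Notation cut E X := (delta_in (del_arcs D E) X).
Local Notation p := (max_deficiency R D s k r).
Local Notation S := (delta_out D [set s]).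

Lemma in_cutI (E : {set A}) (X : {set V}) (v : V) (a : A) :
  (a \in cut E X :&: delta_in D [set v]) =
  [&& a \in arcs D, a \notin E, Defs.head D a == v, v \in X,
      tail D a \notin X & tail D a != v].
Proof.
rewrite !inE /=; case: (altP (Defs.head D a =P v)) => [->|]; last by rewrite !andbF.
by do !case: (_ \in _) => //=.
Qed.

Lemma cutI_set0 (E : {set A}) (X : {set V}) (v : V) :
  v \notin X -> cut E X :&: delta_in D [set v] = set0.
Proof.
by move/negPf=> vX; apply/setP=> a; rewrite in_cutI vX /= !andbF inE.
Qed.

(** The inequality holds separately for each [v] other than [s], by cases on whether [v] lies in [X]
    and in [Y]. *)
Lemma rank_sum_uncross (E F : {set A}) (X Y : {set V}) :
  E \subset S -> F \subset S -> X \subset ~: [set s] -> Y \subset ~: [set s] ->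
  (rank_sum D s r (cut (E :&: F) (X :&: Y)) +
     rank_sum D s r (cut (E :|: F) (X :|: Y)) <=
   rank_sum D s r (cut E X) + rank_sum D s r (cut F Y))%N.
Proof.
move=> sE sF sX sY; rewrite /rank_sum -!big_split; apply: leq_sum => v vs /=.
have m := r_matroid vs; have r0 := matroid_rank0 m.
have cutS E' X' : cut E' X' :&: delta_in D [set v] \subset delta_in D [set v].
  exact: subsetIr.
have tail_s (E' : {set A}) a : E' \subset S -> a \in E' -> tail D a = s.
  by move=> sE' aE'; have:= subsetP sE' _ aE'; rewrite !inE => /and3P[_ /eqP].
have sNin (X' : {set V}) : X' \subset ~: [set s] -> s \notin X'.
  by rewrite subsetC sub1set inE.
have [vX|vX] := boolP (v \in X); have [vY|vY] := boolP (v \in Y).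
(* The roles cross over: the cut of [E :|: F] and [X :|: Y] lies in the intersection of the two
   given cuts at [v], the cut of [E :&: F] and [X :&: Y] in their union. *)
- rewrite addnC; apply: (rank_submod_sub m) => //; apply/subsetP => a.
    rewrite in_cutI in_setI !in_cutI !inE !negb_or.
    by case/and5P=> -> /andP[-> ->] -> _ /andP[/andP[-> ->] ->]; rewrite vX vY.
  rewrite in_cutI in_setU !in_cutI !inE !negb_and vX vY /=.
  case/and5P=> -> EF -> /orP XY ->; rewrite !andbT /=.
  (* An arc of [E] is not in [F] and its tail [s] is outside [Y], so it is in the cut of [F] and
     [Y]; symmetrically for [F]. An arc in neither set is placed by its tail, which misses [X] or
     [Y]. *)
  have [aE|aE] := boolP (a \in E).
    by move: EF; rewrite aE (tail_s _ _ sE aE) (sNin Y) ?andbT.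
  have [aF|aF] := boolP (a \in F); last by apply/orP.
  by rewrite (tail_s _ _ sF aF) (sNin X).
(* With [v] in only one of the two sets, one term on each side vanishes and monotonicity compares
   the other two. *)
- rewrite (@cutI_set0 (E :&: F)) ?inE ?(negPf vY) ?andbF //.
  rewrite (cutI_set0 F vY) r0 add0n addn0 (rank_mono m) //.
  apply/subsetP => a; rewrite !in_cutI !inE !negb_or vX.
  by case/and5P=> -> /andP[-> _] -> _ /andP[/andP[-> _] ->].
- rewrite (@cutI_set0 (E :&: F)) ?inE ?(negPf vX) //.
  rewrite (cutI_set0 E vX) r0 !add0n (rank_mono m) //.
  apply/subsetP => a; rewrite !in_cutI !inE !negb_or vY.
  by case/and5P=> -> /andP[_ ->] -> _ /andP[/andP[_ ->] ->].
- by rewrite !cutI_set0 ?inE ?negb_or ?negb_and ?vX ?r0.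
Qed.

Lemma deficiency_uncross (E F : {set A}) (X Y : {set V}) :
  E \subset S -> F \subset S -> X \subset ~: [set s] -> Y \subset ~: [set s] ->
  deficiency R D s k r E X + deficiency R D s k r F Y <=
  deficiency R D s k r (E :&: F) (X :&: Y) +
    deficiency R D s k r (E :|: F) (X :|: Y).
Proof.
move=> sE sF sX sY; rewrite /deficiency addrACA [leRHS]addrACA lerD2l -!opprD lerN2.
by rewrite -!natrD ler_nat rank_sum_uncross.
Qed.

(** The candidate [[set v]] suffices: its rank sum has only the term of [v], which is at most the
    full rank [k]. *)
Lemma max_deficiency_ge0 (E : {set A}) (v : V) : v != s -> 0 <= p E.
Proof.
move=> vs; have sv : [set v] \subset ~: [set s] by rewrite sub1set !inE.
have Vs : ~: [set s] != set0 by apply/set0Pn; exists v; rewrite !inE.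
have [_ /(_ [set v]) ge_p] := max_deficiency_spec R D k r E Vs.
apply: le_trans (ge_p _ sv); last by apply/set0Pn; exists v; rewrite inE.
rewrite subr_ge0 ler_nat /rank_sum (bigD1 v) //= big1 => [|u /andP[us uv]].
  by rewrite addn0 -(r_rank vs) (rank_mono (r_matroid vs)) ?subsetIr.
by rewrite cutI_set0 ?inE // (matroid_rank0 (r_matroid us)).
Qed.

(** An arc whose head is outside [X] never enters [X], so restoring it leaves the cut unchanged. *)
Lemma deficiency_setD1 (E : {set A}) (X : {set V}) (a : A) :
  Defs.head D a \notin X ->
  deficiency R D s k r (E :\ a) X = deficiency R D s k r E X.
Proof.
move=> aX; rewrite /deficiency; congr (_ - (rank_sum _ _ _ _)%:R).
apply/setP=> b; rewrite !inE /=.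
by case: (altP (b =P a)) => [->|//]; rewrite (negPf aX) /= !andbF.
Qed.

Lemma head_in_maximizer (E : {set A}) (X : {set V}) (a : A) :
  E \subset S -> a \in E -> (1 < #|E|)%N -> ~ separable_set p E ->
  X != set0 -> X \subset ~: [set s] -> p E = deficiency R D s k r E X ->
  Defs.head D a \in X.
Proof.
move=> sE aE E_gt1 nsE X0 sX pE; apply/negPn/negP => aX; apply: nsE.
have as_ : Defs.head D a != s.
  by have:= subsetP sE _ aE; rewrite !inE => /and3P[].
have Vs : ~: [set s] != set0 by apply/set0Pn; exists (Defs.head D a); rewrite !inE.
(* Here [E_gt1] is essential: both parts of the separating partition must be nonempty. *)
have Ea0 : E :\ a != set0 by rewrite -card_gt0; move: E_gt1; rewrite (cardsD1 a) aE.
have neq : [set a] != E :\ a.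
  by apply/eqP=> /setP/(_ a); rewrite !inE eqxx.
exists [set [set a]; E :\ a]; split; last 1 first.
- rewrite big_setU1 ?inE //= big_set1 pE -(deficiency_setD1 E aX).
  have [_ ge_p] := max_deficiency_spec R D k r (E :\ a) Vs.
  by rewrite -[X in X <= _]add0r lerD ?(max_deficiency_ge0 _ as_) ?ge_p.
- apply/and3P; split.
  + by rewrite /cover big_setU1 ?inE //= big_set1 setD1K.
  + apply/trivIsetP => B C; rewrite !inE.
    have dis : [disjoint [set a] & E :\ a] by rewrite disjoints1 !inE eqxx.
    by move=> /orP[] /eqP-> /orP[] /eqP->; rewrite ?eqxx // disjoint_sym.
  + rewrite !inE negb_or eq_sym [set0 == _]eq_sym Ea0 andbT.
    by apply/set0Pn; exists a; rewrite inE.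
- by rewrite cards2 neq.
Qed.

End Deficiency.

Theorem theorem3p3 (R : realFieldType) (V A : finType) (D : digraph V A)
    (s : V) (k : nat) (r : V -> {set A} -> nat)
    (k_gt0 : (0 < k)%N)
    (r_matroid : forall v : V, v != s -> is_matroid (delta_in D [set v]) (r v))
    (r_rank : forall v : V, v != s -> r v (delta_in D [set v]) = k)
    (r_cut : forall X : {set V}, X != set0 -> X \subset ~: [set s] ->
       (k <= rank_sum D s r (delta_in D X))%N) :
  near_supermodular (delta_out D [set s]) (max_deficiency R D s k r).
Proof.
move=> E F sE sF nsE nsF /set0Pn[a /[!inE] /andP[aE aF]].
(* A singleton has no partition into two parts, so [head_in_maximizer] does not cover it; but it
   equals [[set a]] and is contained in the other set. *)
have [E_gt1|E_le1] := ltnP 1 #|E|; last first.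
  have /eqP <- : [set a] == E by rewrite eqEcard sub1set aE cards1.
  by rewrite (setIidPl _) ?(setUidPr _) ?sub1set.
have [F_gt1|F_le1] := ltnP 1 #|F|; last first.
  have /eqP <- : [set a] == F by rewrite eqEcard sub1set aF cards1.
  by rewrite (setIidPr _) ?(setUidPl _) ?sub1set // addrC.
have as_ : Defs.head D a != s by have:= subsetP sE _ aE; rewrite !inE => /and3P[].
have Vs : ~: [set s] != set0 by apply/set0Pn; exists (Defs.head D a); rewrite !inE.
have spec := max_deficiency_spec R D k r _ Vs.
have [[X [X0 sX pE]] _] := spec E; have [[Y [Y0 sY pF]] _] := spec F.
have aX : Defs.head D a \in X by apply: (head_in_maximizer _ _ sE aE) pE.
have aY : Defs.head D a \in Y by apply: (head_in_maximizer _ _ sF aF) pF.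
rewrite pE pF; apply: le_trans (deficiency_uncross _ _ _ sE sF sX sY) _ => //.
rewrite lerD //.
(* The head of the common arc [a] lies in both maximizers, which makes [X :&: Y] an admissible
   candidate. *)
- apply: (spec (E :&: F)).2; last by rewrite subIset ?sX.
  by apply/set0Pn; exists (Defs.head D a); rewrite inE aX.
- apply: (spec (E :|: F)).2; last by rewrite subUset sX.
  by apply/set0Pn; exists (Defs.head D a); rewrite inE aX.
Qed.
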